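(* Let $\pi:(\mathcal S^+(n),g^{\mathrm{LE}},\star)\to(\mathcal S^+(n)/\mathrm{Diag}^+(n),g^Q,\star)$, $\pi(\Sigma)=[\Sigma]=\Sigma\star\mathrm{Diag}^+(n)$, be the Riemannian submersion of log-Euclidean Lie groups obtained by quotienting by the log-Euclidean action of $\mathrm{Diag}^+(n)$. Its canonical section is $$s:\mathcal S^+(n)/\mathrm{Diag}^+(n)\longrightarrow\mathcal S^+(n),\qquad[\Sigma]\longmapsto\exp\bigl(\mathrm{off}(\log\Sigma)\bigr),$$ where $\Sigma$ is any choice of representative of $[\Sigma]$, i.e. $\pi(\Sigma)=[\Sigma]$.
   Context: $\mathcal S(n)$ = real symmetric $n\times n$ matrices, $\mathcal S^+(n)$ = symmetric positive-definite ones, $\mathrm{Diag}(n)$ = diagonal matrices, $\mathrm{Diag}^+(n)$ = diagonal matrices with positive diagonal entries. $\exp,\log$ are the matrix exponential and logarithm ($\log:\mathcal S^+(n)\to\mathcal S(n)$ is a diffeomorphism); $\mathrm{off}(A)=A-\mathrm{Diag}(A)$ sets the diagonal of $A$ to zero. The log-Euclidean group law on $\mathcal S^+(n)$ is $\Sigma_1\star\Sigma_2=\exp(\log\Sigma_1+\log\Sigma_2)$; $\mathrm{Diag}^+(n)$ is a closed connected subgroup, with quotient group $\mathcal S^+(n)/\mathrm{Diag}^+(n)$. $g^{\mathrm{LE}}=\log^*\langle\cdot,\cdot\rangle$ is the pullback of the Frobenius inner product $\langle A,B\rangle=\mathrm{tr}(AB)$, and $g^Q$ is the unique metric making $\pi$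 a Riemannian submersion. For a log-Euclidean Lie group $G$ (a manifold with a diffeomorphism $\log_G:G\to\mathfrak g$ onto a vector space, inverse $\exp_G$, and group law transported from addition), with metric $\log_G^*\langle\cdot,\cdot\rangle$ and connected closed subgroup $H$, $\mathfrak h=\log_G(H)$, the canonical section of $\pi:G\to G/H$ is $[p]\mapsto\exp_G(s_{\mathrm{lin}}(\log_G(p)+\mathfrak h))$, where $s_{\mathrm{lin}}:\mathfrak g/\mathfrak h\to\mathfrak h^\perp$ is the inverse of $\mathfrak h^\perp\to\mathfrak g/\mathfrak h$, $X\mapsto X+\mathfrak h$; it is the unique smooth section that is both an isometric embedding $(G/H,g^Q)\hookrightarrow(G,g)$ and a Lie group homomorphism. *)

(* Defs.v *)
From HB Require Import structures.
From mathcomp Require Import all_boot all_order all_algebra.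
From mathcomp Require Import complex.
From mathcomp Require Import all_classical all_reals all_analysis.

Set Implicit Arguments.
Unset Strict Implicit.
Unset Printing Implicit Defensive.
Import Order.TTheory GRing.Theory Num.Theory numFieldNormedType.Exports.
Local Open Scope classical_set_scope.
Local Open Scope ring_scope.

Section MatrixExpLog.
Variables (R : realType) (n : nat).
Implicit Types (A B P : 'M[R]_n) (d e : 'rV[R]_n).

Definition expm A : 'M[R]_n :=
  limn (series (fun k => (k`!%:R : R)^-1 *: A ^+ k)).

Definition posdefmx A : Prop :=
  A^T = A /\ forall u : 'rV[R]_n, u != 0 -> 0 < (u *m A *m u^T) 0 0.

(* The inverse of [expm] from the symmetric matrices to the positive definite
   ones: see [logm_spec] and [expmK]. *)
Definition logm A : 'M[R]_n := xget 0 [set X | X^T = X /\ expm X = A].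

Definition off A : 'M[R]_n := A - diag_mx (\row_i A i i).

Lemma symmx_diagonalizable A : A^T = A ->
  exists P, exists d, P \in unitmx /\ A = invmx P *m diag_mx d *m P.
Proof.
move=> Asym; pose C := complex R; pose rc := real_complex R.
have rcreal x : rc x \is Num.real.
  by rewrite complex_real.
pose AC : 'M[C]_n := map_mx rc A.
have ACsym : AC^T = AC by rewrite /AC map_trmx Asym.
have ACr : AC \is a mxOver Num.real by apply/mxOverP => i j; rewrite mxE.
have ACh : AC \is hermsymmx.
  by apply: realsym_hermsym => //; apply/is_hermitianmxP; rewrite expr0 scale1r map_mx_id ?ACsym.
have /orthomx_spectralP ACE := hermitian_normalmx ACh.
have dr := hermitian_spectral_diag_real ACh.
have DrC : diag_mx (spectral_diag AC) \is a mxOver Num.real.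
  apply/mxOverP => i j; rewrite !mxE; have := mxOverP dr 0 i.
  by case: (i == j) => // ; rewrite mulr0n.
have sim : similar_in unitmx AC (diag_mx (spectral_diag AC)).
  exists (spectralmx AC); first exact: spectral_unit.
  apply/similarP; first exact: spectral_unit.
  set S := spectralmx AC in ACE *; set D := diag_mx _ in ACE *.
  have Su : S \in unitmx by exact: spectral_unit.
  by rewrite [in LHS]ACE -mulmxA mulKVmx.
have [Q /andP[Qr Qu] /similarP] := real_similar sim ACr DrC.
move=> /(_ Qu) QE.
pose P := map_mx (@complex.Re R) Q; pose d := map_mx (@complex.Re R) (spectral_diag AC).
have rcRe (z : C) : z \is Num.real -> rc (complex.Re z) = z.
  by move=> zr; exact: RRe_real.
have QP : Q = map_mx rc P.
  by apply/matrixP => i j; rewrite !mxE rcRe //; exact: (mxOverP Qr).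
have dE : spectral_diag AC = map_mx rc d.
  by apply/matrixP => i j; rewrite !mxE rcRe //; exact: (mxOverP dr).
have Pu : P \in unitmx by move: Qu; rewrite QP map_unitmx.
exists P, d; split => //.
move: QE; rewrite QP dE -map_diag_mx -!map_mxM => /map_mx_inj QE.
by rewrite -mulmxA -QE mulKmx.
Qed.


Lemma cvg_mx (F : nat -> 'M[R]_n) A :
  (forall i j, (F k i j @[k --> \oo]) --> A i j) -> F @ \oo --> A.
Proof.
move=> FA; apply/cvg_ballP => e e0.
have H : \forall k \near \oo, forall ij : 'I_n * 'I_n,
    ball (A ij.1 ij.2) e (F k ij.1 ij.2).
  by apply: filter_forall => -[i j] /=; move/cvg_ballP : (FA i j); exact.
by apply: filterS H => k Hk; split=> // i j; exact: (Hk (i, j)).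
Qed.

Lemma expm_conj_diag P d : P \in unitmx ->
  expm (invmx P *m diag_mx d *m P) = invmx P *m diag_mx (map_mx expR d) *m P.
Proof.
move=> Pu; set A := invmx P *m _ *m P.
have AX k : A ^+ k = invmx P *m diag_mx (map_mx (fun x => x ^+ k) d) *m P.
  elim: k => [|k IH].
    rewrite expr0; have -> : diag_mx (map_mx (fun x => x ^+ 0) d) = 1%:M.
      by apply/matrixP => i j; rewrite !mxE expr0.
    by rewrite mulmx1 mulVmx.
  rewrite exprS IH -mulmxE /A !mulmxA mulmxK// -(mulmxA (invmx P)) mulmx_diag.
  by congr (_ *m diag_mx _ *m _); apply/rowP => i; rewrite !mxE exprS.
apply/cvg_lim; first exact: norm_hausdorff.
have sE k : series (fun k => (k`!%:R : R)^-1 *: A ^+ k) k =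
    invmx P *m diag_mx (\row_j series (exp_coeff (d 0 j)) k) *m P.
  rewrite /series /=; elim: k => [|k IH].
    have D0 D : D = 0 -> 0 = invmx P *m diag_mx D *m P.
      by move=> ->; rewrite raddf0 mulmx0 mul0mx.
    by rewrite big_geq//; apply: D0; apply/rowP => j; rewrite !mxE big_geq.
  rewrite big_nat_recr//= IH AX scalemxAl scalemxAr -mulmxDl -mulmxDr.
  rewrite -linearZ -raddfD; congr (_ *m diag_mx _ *m _).
  by apply/rowP => j; rewrite !mxE big_nat_recr//= mulrC.
apply: cvg_mx => i j.
have entE D : (invmx P *m diag_mx D *m P) i j =
    \sum_k invmx P i k * D 0 k * P k j.
  by rewrite mxE; apply: eq_bigr => k _; rewrite mul_mx_diag mxE.
under eq_fun do rewrite sE entE; rewrite entE.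
apply: cvg_big => [|k _]; first exact: add_continuous.
rewrite mxE; under eq_fun do rewrite mxE.
apply: cvgMr_tmp; apply: cvgMl_tmp.
exact: is_cvg_series_exp_coeff.
Qed.

(* An intertwiner of two diagonal matrices intertwines their images under any
   function applied to the diagonals. *)
Lemma diag_intertwine (f : R -> R) d e A :
  diag_mx d *m A = A *m diag_mx e ->
  diag_mx (map_mx f d) *m A = A *m diag_mx (map_mx f e).
Proof.
rewrite !mul_diag_mx !mul_mx_diag => /matrixP dA; apply/matrixP => i j.
have := dA i j; rewrite !mxE mulrC.
have [->|A0] := eqVneq (A i j) 0; first by move=> _; rewrite mulr0 mul0r.
by move=> /(mulfI A0) ->; rewrite mulrC.
Qed.

Lemma conj_eqP P Q A B : P \in unitmx -> Q \in unitmx ->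
  invmx P *m A *m P = Q *m B *m invmx Q <-> A *m (P *m Q) = P *m Q *m B.
Proof.
move=> Pu Qu; split=> H.
- have := congr1 (fun X => P *m X *m Q) H.
  by rewrite /= !mulmxA mulmxV// mul1mx mulmxKV.
- have := congr1 (fun X => invmx P *m X *m invmx Q) H.
  by rewrite /= !mulmxA mulmxK// mulVmx// mul1mx.
Qed.

Lemma conj_diag_sym (f : R -> R) P d : P \in unitmx ->
  (invmx P *m diag_mx d *m P)^T = invmx P *m diag_mx d *m P ->
  (invmx P *m diag_mx (map_mx f d) *m P)^T =
  invmx P *m diag_mx (map_mx f d) *m P.
Proof.
have tE e : (invmx P *m diag_mx e *m P)^T = P^T *m diag_mx e *m invmx P^T.
  by rewrite !trmx_mul tr_diag_mx trmx_inv mulmxA.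
move=> Pu; have Ptu : P^T \in unitmx by rewrite unitmx_tr.
rewrite !tE => /esym/conj_eqP-/(_ Pu Ptu)/(diag_intertwine f) dE.
by apply: esym; apply/conj_eqP.
Qed.

Lemma expm_inj A B : A^T = A -> B^T = B -> expm A = expm B -> A = B.
Proof.
move=> /symmx_diagonalizable[P [d [Pu ->]]] /symmx_diagonalizable[Q [e [Qu ->]]].
rewrite !expm_conj_diag// => E.
have Q'u : invmx Q \in unitmx by rewrite unitmx_inv.
have cE (D : 'M[R]_n) : invmx Q *m D *m Q = invmx Q *m D *m invmx (invmx Q).
  by rewrite invmxK.
rewrite !cE; apply/conj_eqP => //.
move: E; rewrite cE => /conj_eqP-/(_ Pu Q'u)/(diag_intertwine (@ln R)).
have lnE (v : 'rV[R]_n) : map_mx (@ln R) (map_mx expR v) = v.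
  by apply/rowP => i; rewrite !mxE expRK.
by rewrite !lnE.
Qed.

Lemma mulmx_tr_ge0 (u : 'rV[R]_n) : 0 <= (u *m u^T) 0 0.
Proof. by rewrite mxE sumr_ge0// => i _; rewrite mxE -expr2 sqr_ge0. Qed.

Lemma mulmx_tr_gt0 (u : 'rV[R]_n) : u != 0 -> 0 < (u *m u^T) 0 0.
Proof.
move=> u0; rewrite lt_neqAle mulmx_tr_ge0 andbT eq_sym; apply: contra u0.
rewrite mxE psumr_eq0; last by move=> i _; rewrite mxE -expr2 sqr_ge0.
move=> /allP H; apply/eqP/rowP => i; have := H i; rewrite mem_index_enum.
by move=> /(_ isT); rewrite !mxE -expr2 sqrf_eq0 => /eqP.
Qed.

Lemma expm_posdef A : A^T = A -> posdefmx (expm A).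
Proof.
move=> At; have [P [d [Pu AE]]] := symmx_diagonalizable At.
rewrite AE in At *; rewrite expm_conj_diag//.
split=> [|u u0]; first exact: conj_diag_sym.
pose H := invmx P *m diag_mx (map_mx (fun x => expR (x / 2)) d) *m P.
have HH : H *m H = invmx P *m diag_mx (map_mx expR d) *m P.
  rewrite /H !mulmxA mulmxK// -(mulmxA (invmx P)) mulmx_diag.
  congr (_ *m diag_mx _ *m _); apply/rowP => i.
  by rewrite !mxE -expRD -splitr.
have Ht : H^T = H by exact: conj_diag_sym.
have Hu : H \in unitmx.
  rewrite /H !unitmx_mul unitmx_inv Pu/= andbT unitmxE det_diag unitfE.
  by rewrite gt_eqF// prodr_gt0// => i _; rewrite mxE expR_gt0.
rewrite -HH; have -> : u *m (H *m H) *m u^T = (u *m H) *m (u *m H)^T.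
  by rewrite trmx_mul Ht !mulmxA.
rewrite mulmx_tr_gt0//.
by apply: contra u0 => /eqP uH; rewrite -(mulmxK Hu u) uH mul0mx.
Qed.

Lemma expm_surj A : posdefmx A -> exists X, X^T = X /\ expm X = A.
Proof.
move=> [At Apos]; have [P [d [Pu AE]]] := symmx_diagonalizable At.
exists (invmx P *m diag_mx (map_mx (@ln R) d) *m P).
split; first by apply: conj_diag_sym => //; rewrite -AE.
rewrite expm_conj_diag// AE; congr (_ *m diag_mx _ *m _).
apply/rowP => i; rewrite !mxE lnK// posrE.
have r0 : row i P != 0.
  apply: contraTneq Pu => r0; rewrite -row_free_unit; apply/negP => /row_freeP.
  case=> B /(congr1 (row i)); rewrite row_mul r0 mul0mx => /rowP/(_ i).
  by rewrite !mxE eqxx => /esym/eqP; rewrite oner_eq0.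
have := Apos _ r0.
have -> : row i P *m A = d 0 i *: row i P.
  by rewrite AE !mulmxA -row_mul mulmxV// row1 -rowE row_diag_mx -scalemxAl -rowE.
rewrite -scalemxAl mxE pmulr_lgt0//.
exact: mulmx_tr_gt0.
Qed.

Lemma expm_diag d : expm (diag_mx d) = diag_mx (map_mx expR d).
Proof.
have := expm_conj_diag d (unitmx1 R n).
by rewrite invmx1 !mul1mx !mulmx1.
Qed.

Lemma logm_spec A : posdefmx A -> (logm A)^T = logm A /\ expm (logm A) = A.
Proof. by move=> /expm_surj; exact: xgetPex. Qed.

Lemma expmK A : A^T = A -> logm (expm A) = A.
Proof.
by move=> At; have [? ?] := logm_spec (expm_posdef At); apply: expm_inj.
Qed.

End MatrixExpLog.

(* A log-Euclidean Lie group: its manifold structure and its group law are those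
   transported along [le_log] from the vector space [le_alg], and its metric is
   the pullback by [le_log] of the inner product [le_dot]. *)
Record leGroup (R : realType) := LEGroup {
  le_sort :> Type;
  le_alg : vectType R;
  le_dot : {dot le_alg for idfun};
  le_log : le_sort -> le_alg;
  le_exp : le_alg -> le_sort;
  le_logK : cancel le_log le_exp;
  le_expK : cancel le_exp le_log }.

Definition le_mul (R : realType) (G : leGroup R) (p q : G) : G :=
  le_exp (le_log p + le_log q).

(* A subgroup, given with its Lie algebra log H. A subgroup is connected and
   closed exactly when log H is a linear subspace, hence a [{vspace _}]. *)
Record leSubgroup (R : realType) (G : leGroup R) := LESubgroup {
  les_set :> set G;
  les_alg : {vspace le_alg G};
  les_log : @le_log R G @` les_set = [set` les_alg] }.

Section CanonicalSection.
Variables (R : realType) (G : leGroup R) (H : leSubgroup G).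

Definition le_coset (p : G) : set G := [set le_mul p q | q in H].

Definition le_quotient : Type := {C : set G | exists p, le_coset p = C}.

Definition le_pi (p : G) : le_quotient :=
  exist _ (le_coset p) (ex_intro _ p erefl).

Definition le_repr (C : le_quotient) : G := sval (cid (svalP C)).

Definition alg_coset (X : le_alg G) : set (le_alg G) :=
  [set X + Y | Y in [set` les_alg H]].

(* The inverse of the map from the orthogonal complement of [log H] to the
   cosets of [log H] sending [X] to its coset. *)
Definition s_lin : set (le_alg G) -> le_alg G :=
  'pinv_(fun=> 0) [set` orthov (le_dot G) (les_alg H)] alg_coset.

Definition canonical_section (C : le_quotient) : G :=
  le_exp (s_lin (alg_coset (le_log (le_repr C)))).

End CanonicalSection.

Section SymmetricPositiveDefinite.
Variables (R : realType) (n : nat).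

Definition symv : {vspace 'M[R]_n} := fixedSpace (linfun (@trmx R n n)).

Lemma symvP (A : 'M[R]_n) : reflect (A^T = A) (A \in symv).
Proof. by apply: (iffP fixedSpaceP); rewrite lfunE. Qed.

Definition sym : vectType R := subvs_of symv.

Lemma sym_tr (X : sym) : (vsval X)^T = vsval X.
Proof. exact/symvP/subvsP. Qed.

Definition spd : Type := {S : 'M[R]_n | posdefmx S}.

Definition frobenius (X Y : sym) : R := \tr (vsval X *m vsval Y).

Fact frobenius_bilinear : bilinear_for *%R (idfun \; *%R) frobenius.
Proof.
split=> [Y a X1 X2|X a Y1 Y2] /=; rewrite /frobenius.
  have -> : vsval (a *: X1 + X2) = a *: vsval X1 + vsval X2 by exact: linearP.
  by rewrite mulmxDl -scalemxAl linearP.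
have -> : vsval (a *: Y1 + Y2) = a *: vsval Y1 + vsval Y2 by exact: linearP.
by rewrite mulmxDr -scalemxAr linearP.
Qed.

HB.instance Definition _ := bilinear_isBilinear.Build R sym sym R *%R
  (idfun \; *%R) frobenius frobenius_bilinear.

Fact frobenius_hermitian (X Y : sym) :
  frobenius X Y = (-1) ^+ false * idfun (frobenius Y X).
Proof. by rewrite expr0 mul1r /frobenius mxtrace_mulC. Qed.

HB.instance Definition _ :=
  isHermitianSesquilinear.Build R sym false idfun frobenius frobenius_hermitian.

Fact frobenius_gt0 (X : sym) : X != 0 -> 0 < frobenius X X.
Proof.
move=> X0; have tE : frobenius X X = \sum_i \sum_j (vsval X i j) ^+ 2.
  rewrite /frobenius -{1}sym_tr /mxtrace exchange_big /=.
  by apply: eq_bigr => i _; rewrite mxE; apply: eq_bigr => j _; rewrite mxE.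
have s0 i : 0 <= \sum_j (vsval X i j) ^+ 2.
  by apply: sumr_ge0 => j _; exact: sqr_ge0.
rewrite tE lt_neqAle sumr_ge0// andbT eq_sym; apply: contra X0.
rewrite psumr_eq0// => /allP Xs; apply/eqP/val_inj/matrixP => i j.
have /= := Xs i (mem_index_enum _).
rewrite psumr_eq0 => [/allP /(_ j (mem_index_enum _))|k _]; last exact: sqr_ge0.
by rewrite sqrf_eq0 mxE => /eqP.
Qed.

HB.instance Definition _ := isDotProduct.Build R sym frobenius frobenius_gt0.


Lemma spd_val_inj : injective (@sval 'M[R]_n (@posdefmx R n)).
Proof. by move=> [S HS] [T HT] /= ST; exact: eq_exist. Qed.

Definition spd_log (S : spd) : sym :=
  Subvs (introT (symvP _) (logm_spec (svalP S)).1).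

Definition spd_exp (X : sym) : spd :=
  exist _ (expm (vsval X)) (expm_posdef (sym_tr X)).

Fact spd_logK : cancel spd_log spd_exp.
Proof. by move=> S; apply: spd_val_inj; exact: (logm_spec (svalP S)).2. Qed.

Fact spd_expK : cancel spd_exp spd_log.
Proof. by move=> X; apply: val_inj; exact/expmK/sym_tr. Qed.

Definition spd_leGroup : leGroup R :=
  LEGroup (frobenius : {dot sym for idfun}) spd_logK spd_expK.

Definition diagpd : set spd :=
  [set S | is_diag_mx (sval S) /\ forall i, 0 < sval S i i].

Definition off_sym (X : sym) : 'M[R]_n := off (vsval X).

Fact off_sym_linear : linear off_sym.
Proof.
move=> a X Y; rewrite /off_sym /off.
have -> : vsval (a *: X + Y) = a *: vsval X + vsval Y by exact: linearP.
apply/matrixP => i j; rewrite !mxE.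
by case: eqP => [->|_]; rewrite ?mulr0n ?subr0// !mulr1n !subrr mulr0 addr0.
Qed.

HB.instance Definition _ :=
  GRing.isLinear.Build R sym 'M[R]_n *:%R off_sym off_sym_linear.

(* Diag(n), as a subspace of S(n). *)
Definition diagv : {vspace sym} := lker (linfun off_sym).

Lemma diagvP (X : sym) : reflect (is_diag_mx (vsval X)) (X \in diagv).
Proof.
rewrite memv_ker lfunE /= /off_sym /off subr_eq0.
apply: (iffP eqP) => [->|/diag_mxP[d ->]]; first exact: diag_mx_is_diag.
by congr diag_mx; apply/rowP => i; rewrite !mxE eqxx.
Qed.

Fact diagpd_log : spd_log @` diagpd = [set` diagv].
Proof.
apply/seteqP; split=> [_ [S [/diag_mxP[d Sd] Spos] <-]|X /diagvP Xdiag].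
  apply/diagvP => /=; rewrite Sd.
  have -> : d = map_mx expR (map_mx (@ln R) d).
    apply/rowP => i; rewrite !mxE lnK// posrE.
    by have := Spos i; rewrite Sd mxE eqxx.
  by rewrite -expm_diag expmK ?tr_diag_mx// diag_mx_is_diag.
exists (spd_exp X); last exact: spd_expK.
have /diag_mxP[d Xd] := Xdiag.
rewrite /diagpd /= Xd expm_diag; split=> [|i]; first exact: diag_mx_is_diag.
by rewrite !mxE eqxx mulr1n expR_gt0.
Qed.

Definition diag_leSubgroup : leSubgroup spd_leGroup :=
  @LESubgroup R spd_leGroup diagpd diagv diagpd_log.

End SymmetricPositiveDefinite.

(* Main.v *)
(* A coset of [log H] meets the orthogonal complement of [log H] in at most one
   point, because the inner product is definite; so the canonical section at the
   class of [p] is [exp Y] for any [Y] orthogonal to [log H] with [log p - Y] in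
   [log H]. On symmetric matrices a diagonal matrix and a matrix with zero
   diagonal are Frobenius-orthogonal, so [Y = off (log S)] qualifies. *)
Require Import Defs.
From mathcomp Require Import all_boot all_order all_algebra.
From mathcomp Require Import all_classical all_reals all_analysis.

Set Implicit Arguments.
Unset Strict Implicit.
Unset Printing Implicit Defensive.
Import Order.TTheory GRing.Theory Num.Theory.
Local Open Scope classical_set_scope.
Local Open Scope ring_scope.

Section CanonicalSectionTheory.
Variables (R : realType) (G : leGroup R) (H : leSubgroup G).
Implicit Types (X Y : le_alg G) (p q : G).

Lemma alg_cosetP X Y :
  alg_coset H X = alg_coset H Y <-> X - Y \in les_alg H.
Proof.
split=> [XY|XYH].
  have : alg_coset H X X by exists 0; rewrite ?addr0//= mem0v.
  by rewrite XY => -[Z /= ZH <-]; rewrite addrAC subrr add0r.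
apply/seteqP; split=> _ [Z /= ZH <-].
  by exists (X - Y + Z); [exact: memvD | rewrite addrA subrKC].
exists (Y - X + Z); last by rewrite addrA subrKC.
by rewrite /= memvD// -opprB memvN.
Qed.

(** The difference of two such points lies both in [log H] and in its orthogonal complement, so it
    is orthogonal to itself. *)
Lemma alg_coset_inj_orthov :
  {in [set` orthov (le_dot G) (les_alg H)] &, injective (alg_coset H)}.
Proof.
move=> X Y /[!inE]/= XH YH /alg_cosetP XYH; apply/eqP; rewrite -subr_eq0.
apply/negPn/negP => XY0.
have /mem_orthovP/(_ _ XYH) XY : X - Y \in orthov (le_dot G) (les_alg H).
  exact: memvB.
by have := neq0_dnorm_gt0 (s := le_dot G) _ XY0; rewrite XY ltxx.
Qed.

Lemma s_linE X Y : Y \in orthov (le_dot G) (les_alg H) ->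
  X - Y \in les_alg H -> s_lin H (alg_coset H X) = Y.
Proof.
(* [Y] represents the same coset as [X] and lies where ['pinv_] inverts [alg_coset]. *)
move=> YH /alg_cosetP ->; apply: (pinvKV _ alg_coset_inj_orthov).
by rewrite inE.
Qed.

Lemma le_coset_log p q :
  le_coset H p = le_coset H q -> le_log p - le_log q \in les_alg H.
Proof.
move=> pq; have : le_coset H p p.
  (* Since [0] is in [log H], the neutral element is in [H]. *)
  have : (@le_log R G @` H) 0 by rewrite les_log /= mem0v.
  by case=> e He e0; exists e => //; rewrite /le_mul e0 addr0 le_logK.
rewrite pq => -[r Hr <-]; rewrite /le_mul le_expK addrAC subrr add0r.
have : (@le_log R G @` H) (le_log r) by exists r.
by rewrite les_log.
Qed.

Lemma canonical_section_pi p Y : Y \in orthov (le_dot G) (les_alg H) ->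
  le_log p - Y \in les_alg H -> canonical_section (le_pi H p) = le_exp Y.
Proof.
move=> YH pYH; congr le_exp; apply: s_linE => //.
set q := le_repr _.
have qp : le_coset H q = le_coset H p by exact: svalP (cid (svalP (le_pi H p))).
(* The chosen representative [q] may differ from [p], but [log q - Y] splits as
   [(log q - log p) + (log p - Y)], with both terms in [log H]. *)
by rewrite -(subrKA (le_log p)) memvD// le_coset_log.
Qed.

End CanonicalSectionTheory.

Section Off.
Variables (R : realType) (n : nat).

Lemma tr_off (A : 'M[R]_n) : A^T = A -> (off A)^T = off A.
Proof. by move=> At; rewrite /off linearB/= At tr_diag_mx. Qed.

Lemma off_diag (A : 'M[R]_n) i : off A i i = 0.
Proof. by rewrite !mxE eqxx mulr1n subrr. Qed.

(** Right multiplication by [D] only rescales columns, so the diagonal stays zero. This makes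
    [off (log S)] orthogonal to [Diag(n)]. *)
Lemma mxtrace_mul_diag_mx (A D : 'M[R]_n) :
  (forall i, A i i = 0) -> is_diag_mx D -> \tr (A *m D) = 0.
Proof.
move=> A0 /diag_mxP[d ->]; rewrite /mxtrace big1// => i _.
by rewrite mul_mx_diag mxE A0 mul0r.
Qed.

End Off.

Theorem theorem4p19 (R : realType) (n : nat)
    (C : le_quotient (diag_leSubgroup R n)) (S : spd R n) :
  le_pi (diag_leSubgroup R n) S = C ->
  sval (canonical_section C) = expm (off (logm (sval S))).
Proof.
move=> <-; have logS_sym := (logm_spec (svalP S)).1.
pose Y : sym R n := Subvs (introT (symvP _) (tr_off logS_sym)).
rewrite (@canonical_section_pi _ _ (diag_leSubgroup R n) S Y)//.
  apply/mem_orthovP => D /diagvP D_diag.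
  by apply: mxtrace_mul_diag_mx => // i; exact: off_diag.
(* The subtraction in [sym] is that of the underlying matrices, and [A - off A] is the diagonal part
   of [A]. *)
apply/diagvP; change (is_diag_mx (logm (sval S) - off (logm (sval S)))).
by rewrite /off subKr diag_mx_is_diag.
Qed.
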